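(* Let $\Omega \subseteq \mathbb{R}^n$ be an open connected set, let $F$ be a Finsler metric on $\Omega$, let $X \subset \Omega$ be a finite set of points, and let $\epsilon > 0$. Then $$\mathrm{Rips}(X,\epsilon) \subseteq \Delta(X,\epsilon) \subseteq \mathrm{Rips}(X,2\epsilon).$$
   Context: A Finsler metric on an open set $\Omega\subseteq\mathbb{R}^n$ is a continuous function $F: T\Omega \cong \Omega\times\mathbb{R}^n \to \mathbb{R}$ such that: (i) $F$ is $C^\infty$ on $\{(p,v): v\neq 0\}$; (ii) $F(p,v)>0$ for $v\ne 0$; (iii) $F(p,rv)=rF(p,v)$ for all $r>0$; (iv) the matrix $g_{ij}(p,v)=\frac12\frac{\partial^2 F^2}{\partial v^i\partial v^j}(p,v)$ is positive definite for $v\neq 0$. It is not assumed that $F(p,-v)=F(p,v)$. Write $F_p(v)=F(p,v)$. Identifying each tangent space $T_p\Omega$ with $\mathbb{R}^n$, for $p\in\Omega$ and $x,y\in\mathbb{R}^n$ set $d_p(x,y)=F_p(y-x)$ (the forward distance). For a finite set $X\subset\Omega$ and $\epsilon>0$: - the generalized Vietoris-Rips complex $\mathrm{Rips}(X,\epsilon)$ is the abstract simplicial complex with vertex set $X$ in which $\{p_1,\dots,p_{k+1}\}\subset X$ spans a $k$-simplex iff $d_{p_i}(p_i,p_j)\le\epsilon$ for all $p_i,p_j\in\{p_1,\dots,p_{k+1}\}$; - $\Delta(X,\epsilon)$ is the abstract simplicial complex with vertex set $X$ in which $\{p_1,\dots,p_{k+1}\}\subset X$ spans a $k$-simplex iff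 $d_{p_i}(p_i,p_j)+d_{p_j}(p_j,p_i)\le 2\epsilon$ for all $p_i,p_j\in\{p_1,\dots,p_{k+1}\}$. *)

(* Defs.v *)
From HB Require Import structures.
From mathcomp Require Import all_boot all_order all_algebra finmap.
From mathcomp Require Import boolp classical_sets reals topology normedtype derive.

Set Implicit Arguments.
Unset Strict Implicit.
Unset Printing Implicit Defensive.

Import Order.TTheory GRing.Theory Num.Theory.
Import numFieldTopology.Exports numFieldNormedType.Exports.

Local Open Scope classical_set_scope.
Local Open Scope ring_scope.

(* Meant for U open and V finite-dimensional: then continuity of every
   directional derivative is continuity of the differential. *)
Fixpoint Ck_on (R : realType) (V W : normedModType R) (k : nat) (U : set V)
    (f : V -> W) : Prop :=
  if k is k'.+1 then
    (forall x, U x -> differentiable f x) /\ (forall v, Ck_on k' U ('D_v f))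
  else {within U, continuous f}.

Definition smooth_on (R : realType) (V W : normedModType R) (U : set V)
    (f : V -> W) : Prop :=
  forall k, Ck_on k U f.

Definition posdefmx (R : realType) (n : nat) (A : 'M[R]_n) : Prop :=
  A^T = A /\ forall w : 'rV[R]_n, w != 0 -> 0 < (w *m A *m w^T) 0 0.

Definition fundamental_tensor (R : realType) (n : nat)
    (F : 'rV[R]_n * 'rV[R]_n -> R) (p v : 'rV[R]_n) : 'M[R]_n :=
  let e (i : 'I_n) : 'rV[R]_n := delta_mx 0 i in
  \matrix_(i, j) (2^-1 * 'D_(e i) ('D_(e j) (fun w => F (p, w) ^+ 2)) v).

(* T Omega is Omega `*` setT; the values of F outside of it are irrelevant.
   No reversibility F (p, - v) = F (p, v) is required. *)
Record is_finsler_metric (R : realType) (n : nat) (Omega : set 'rV[R]_n)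
    (F : 'rV[R]_n * 'rV[R]_n -> R) : Prop := IsFinslerMetric {
  finsler_continuous : {within Omega `*` setT, continuous F} ;
  finsler_smooth :
    smooth_on (Omega `*` [set v : 'rV[R]_n | v != 0]) F ;
  finsler_gt0 : forall p v, Omega p -> v != 0 -> 0 < F (p, v) ;
  finsler_homogeneous : forall p v (r : R),
    Omega p -> 0 < r -> F (p, r *: v) = r * F (p, v) ;
  finsler_posdef : forall p v,
    Omega p -> v != 0 -> posdefmx (fundamental_tensor F p v) }.

Definition forward_dist (R : realType) (n : nat)
    (F : 'rV[R]_n * 'rV[R]_n -> R) (p x y : 'rV[R]_n) : R :=
  F (p, y - x).

(* A complex is given by its set of simplices, a simplex by its vertices;
   the empty set is not a simplex. *)
Record is_simplicial_complex (T : choiceType) (X : {fset T})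
    (K : set {fset T}) : Prop := IsSimplicialComplex {
  simplex_neq0 : forall s, K s -> s != fset0 ;
  simplex_sub : forall s, K s -> (s `<=` X)%fset ;
  simplex_vertex : forall x, x \in X -> K [fset x]%fset ;
  simplex_face : forall s t, K s -> (t `<=` s)%fset -> t != fset0 -> K t }.

Definition Rips (R : realType) (n : nat) (F : 'rV[R]_n * 'rV[R]_n -> R)
    (X : {fset 'rV[R]_n}) (eps : R) : set {fset 'rV[R]_n} :=
  [set s | [/\ s != fset0, (s `<=` X)%fset &
    forall p q, p \in s -> q \in s -> forward_dist F p p q <= eps]].

Definition Delta (R : realType) (n : nat) (F : 'rV[R]_n * 'rV[R]_n -> R)
    (X : {fset 'rV[R]_n}) (eps : R) : set {fset 'rV[R]_n} :=
  [set s | [/\ s != fset0, (s `<=` X)%fset &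
    forall p q, p \in s -> q \in s ->
      forward_dist F p p q + forward_dist F q q p <= 2 * eps]].

Lemma forward_distxx (R : realType) (n : nat) (Omega : set 'rV[R]_n)
    (F : 'rV[R]_n * 'rV[R]_n -> R) (p x : 'rV[R]_n) :
  is_finsler_metric Omega F -> Omega p -> forward_dist F p x x = 0.
Proof.
move=> FF Op; rewrite /forward_dist subrr.
have := finsler_homogeneous FF 0 Op (ltr0n R 2).
rewrite scaler0 mulr_natl mulr2n => /eqP.
by rewrite -subr_eq subrr eq_sym => /eqP.
Qed.

Lemma Rips_is_simplicial_complex (R : realType) (n : nat)
    (Omega : set 'rV[R]_n) (F : 'rV[R]_n * 'rV[R]_n -> R)
    (X : {fset 'rV[R]_n}) (eps : R) :
  is_finsler_metric Omega F -> (forall x, x \in X -> Omega x) -> 0 < eps ->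
  is_simplicial_complex X (Rips F X eps).
Proof.
move=> FF XO e0; split.
- by move=> s [].
- by move=> s [].
- move=> x xX; split.
  + by apply/fset0Pn; exists x; rewrite inE.
  + by rewrite fsub1set.
  + move=> p q; rewrite !inE => /eqP-> /eqP->.
    by rewrite (forward_distxx _ FF (XO _ xX)) ltW.
- move=> s t [_ sX sd] ts t0; split => //; first exact: fsubset_trans sX.
  by move=> p q /(fsubsetP ts) ps /(fsubsetP ts) qs; exact: sd.
Qed.

Lemma Delta_is_simplicial_complex (R : realType) (n : nat)
    (Omega : set 'rV[R]_n) (F : 'rV[R]_n * 'rV[R]_n -> R)
    (X : {fset 'rV[R]_n}) (eps : R) :
  is_finsler_metric Omega F -> (forall x, x \in X -> Omega x) -> 0 < eps ->
  is_simplicial_complex X (Delta F X eps).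
Proof.
move=> FF XO e0; split.
- by move=> s [].
- by move=> s [].
- move=> x xX; split.
  + by apply/fset0Pn; exists x; rewrite inE.
  + by rewrite fsub1set.
  + move=> p q; rewrite !inE => /eqP-> /eqP->.
    by rewrite !(forward_distxx _ FF (XO _ xX)) addr0 mulr_ge0// ltW.
- move=> s t [_ sX sd] ts t0; split => //; first exact: fsubset_trans sX.
  by move=> p q /(fsubsetP ts) ps /(fsubsetP ts) qs; exact: sd.
Qed.

(* Main.v *)
Require Import Defs.
From HB Require Import structures.
From mathcomp Require Import all_boot all_order all_algebra finmap.
From mathcomp Require Import boolp classical_sets reals topology normedtype derive.

Import Order.TTheory GRing.Theory Num.Theory.
Import numFieldTopology.Exports numFieldNormedType.Exports.

Local Open Scope classical_set_scope.
Local Open Scope ring_scope.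

(** Both inclusions are checked on each ordered pair of vertices. Two forward distances at most
    [eps] add up to at most [2 * eps]; conversely, each of them is bounded by their sum, since the
    other is nonnegative. *)

Lemma forward_dist_ge0 (R : realType) (n : nat) (Omega : set 'rV[R]_n)
    (F : 'rV[R]_n * 'rV[R]_n -> R) (p x y : 'rV[R]_n) :
  is_finsler_metric Omega F -> Omega p -> 0 <= forward_dist F p x y.
Proof.
(* Positivity of [F] covers only nonzero vectors; at the zero vector, homogeneity forces the value
   0. *)
move=> FF Op; have [->|xy] := eqVneq y x.
  by rewrite (forward_distxx _ FF Op).
by apply/ltW/(finsler_gt0 FF) => //; rewrite subr_eq0.
Qed.

Theorem proposition10 (R : realType) (n : nat) (Omega : set 'rV[R]_n)
    (F : 'rV[R]_n * 'rV[R]_n -> R) (X : {fset 'rV[R]_n}) (eps : R)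
    (Omega_open : open Omega) (Omega_connected : connected Omega)
    (F_finsler : is_finsler_metric Omega F)
    (X_Omega : forall x, x \in X -> Omega x) (eps_gt0 : 0 < eps) :
  Rips F X eps `<=` Delta F X eps /\ Delta F X eps `<=` Rips F X (2 * eps).
Proof.
split=> s [s0 sX sd]; split=> // p q ps qs.
  by rewrite mulr_natl mulr2n lerD ?sd.
(* What remains is that the return distance, measured at [q], is nonnegative. *)
apply: le_trans (sd p q ps qs); rewrite lerDl.
by apply: forward_dist_ge0 F_finsler _; apply/X_Omega/(fsubsetP sX).
Qed.
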